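(* For any choice of $\epsilon>0$, depth $L$, and threshold $\gamma$, Algorithm A (defined in the context) is $\epsilon$-locally differentially private. Moreover, suppose that $F$ is $\alpha$-fat for some $\alpha>0$. For a sequence $h_N>0$, let $$\gamma=\sqrt{\frac{4e^{\epsilon/L}(1+e^{\epsilon/L})h_N}{(e^{\epsilon/L}-1)^2N}}.$$ Then, in both the fixed data setting and the i.i.d. data setting, if $\frac{L^2h_N}{\epsilon^2N}=o(1)$ as $N\to\infty$, Algorithm A incurs an error $$\mathrm{Err}=O\left(\left(\frac{L^2h_N}{\epsilon^2N}\right)^{1/(2\alpha)}+e^{-h_N}+2^{-L}\right).$$
   Context: There are $N\ge 2$ users; user $i$ holds $x_i\in[-1,1]$, and $x_{(1)}\le\dots\le x_{(N)}$ are the ordered data. Data generation is described by a non-decreasing function $F:[-1,1]\to[0,1]$ (not depending on $N$), and $x_{\min}=\inf\{x\in[-1,1]:F(x)>0\}$. Fixed data setting: the data are deterministic, with $F(x_{(i)})=(i-1)/(N-1)$ for all $i=1,\dots,N$, and $x_{(1)}=x_{\min}$. I.i.d. data setting: $F$ is the cumulative distribution function of a distribution supported on $[-1,1]$ and $x_1,\dots,x_N$ are drawn i.i.d. from it. $\alpha$-fatness: for $\alpha>0$, $F$ is $\alpha$-fat if there exist constants $C>0$ and $\bar x\in[-1,1]$ with $\bar x>x_{\min}$ such that $F(x)\ge C(x-x_{\min})^\alpha$ for all $x_{\min}<x<\bar x$. Randomized response with privacy parameter $\eta>0$: on input $s\in\{-1,1\}$ it outputs $s$ with probability $e^\eta/(1+e^\eta)$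 and $-s$ with probability $1/(1+e^\eta)$, using fresh independent randomness. Let $\mathrm{sign}(x)=1$ if $x\ge0$ and $-1$ if $x<0$. Algorithm A (locally private minimum finding), with privacy parameter $\epsilon>0$, depth $L$ (a positive integer, which may depend on $N$), and threshold $\gamma$: set $\ell_1=-1$, $r_1=1$. For $t=1,\dots,L$: let $\tau_t=(\ell_t+r_t)/2$; each user $i$ reports $z'_i$, obtained by applying randomized response with privacy parameter $\epsilon/L$ to $\mathrm{sign}(\tau_t-x_i)$; the aggregator computes $\Phi'(z')=\frac1{2N}\frac{e^{\epsilon/L}+1}{e^{\epsilon/L}-1}\sum_{i=1}^Nz'_i+\frac12$; if $\Phi'(z')\ge\gamma$ set $(\ell_{t+1},r_{t+1})=(\ell_t,\tau_t)$, otherwise set $(\ell_{t+1},r_{t+1})=(\tau_t,r_t)$. Output $\tilde x=(\ell_{L+1}+r_{L+1})/2$. Local differential privacy: a stochastic mechanism $\mathcal M$ taking a user's datum $x\in[-1,1]$ and the already revealed sanitized data $z$ is $\epsilon$-locally differentially private if $\Pr\{\mathcal M(x,z)\in S\}\le e^\epsilon\Pr\{\mathcal M(x',z)\in S\}$ for all $x,x'$, all $z$, and all measurable $S$. For the $L$-round protocol above this is understood for each user's total participation: for every user $i$, every fixed data of the other users, all $x,x'\in[-1,1]$ and every set $S$ of transcripts (sequences of all reports over all $L$ rounds), the probability that the transcript lies in $S$ when $x_i=x$ is at most $e^\epsilon$ times that probability when $x_i=x'$. Error: $\mathrm{Err}=\mathbb E[|x_{\min}-\tilde x|]$, over the randomness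 of the algorithm and, in the i.i.d. setting, of the data. The asymptotics are as $N\to\infty$; $L$ and $\epsilon$ may vary with $N$ with $\epsilon$ bounded above, and the hidden constant may depend on $\alpha$, $C$, $\bar x$ and the upper bound on $\epsilon$. *)

(* Defs.v *)
From HB Require Import structures.
From mathcomp Require Import all_boot all_order all_algebra.
From mathcomp Require Import all_classical all_reals all_analysis.

Set Implicit Arguments.
Unset Strict Implicit.
Unset Printing Implicit Defensive.
Import Order.TTheory GRing.Theory Num.Theory.
Import numFieldNormedType.Exports.
Local Open Scope classical_set_scope.
Local Open Scope ring_scope.

Section Data.
Context {R : realType}.

(* F is a function on [-1, 1]; its values outside [-1, 1] are never used. *)
Definition data_function (F : R -> R) : Prop :=
  (forall x, -1 <= x <= 1 -> 0 <= F x <= 1) /\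
  (forall x y, -1 <= x -> x <= y -> y <= 1 -> F x <= F y).

Definition xmin (F : R -> R) : R := inf [set x | -1 <= x <= 1 /\ 0 < F x].

(* alpha-fatness with explicit witnesses C and xbar. If F vanishes on [-1, 1],
   [xmin F] is the default value 0 of [inf set0], and no witnesses exist. *)
Definition fat_with (alpha C xbar : R) (F : R -> R) : Prop :=
  [/\ 0 < C, -1 <= xbar <= 1, xmin F < xbar
    & forall x, xmin F < x < xbar -> C * (x - xmin F) `^ alpha <= F x].

(* 0-based order statistics: [order_stat x k] is x_(k+1). *)
Definition order_stat (N : nat) (x : 'I_N -> R) (k : nat) : R :=
  nth 0 (sort <=%O (codom x)) k.

Definition fixed_data (F : R -> R) (N : nat) (x : 'I_N -> R) : Prop :=
  [/\ forall i, -1 <= x i <= 1,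
      forall k, (k < N)%N -> F (order_stat x k) = k%:R / (N.-1)%:R
    & order_stat x 0%N = xmin F].

End Data.

Section Algorithm.
Context {R : realType}.

Definition sign (x : R) : R := if 0 <= x then 1 else -1.

(* Randomized response driven by a coin c: the input s is kept if c is true and
   negated otherwise. The coin is Bernoulli(e^eta / (1 + e^eta)) and fresh for
   every use: see [coin_law], [fresh_coins] and [iid_experiment]. *)
Definition rr (s : R) (c : bool) : R := if c then s else - s.

Definition Phi' (N : nat) (eta : R) (z : 'I_N -> R) : R :=
  (2 * N%:R)^-1 * ((expR eta + 1) / (expR eta - 1)) * (\sum_(i < N) z i) + 2^-1.

Definition mid (lr : R * R) : R := (lr.1 + lr.2) / 2.

Definition reports (N : nat) (x : 'I_N -> R) (tau : R) (b : 'I_N -> bool) :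
  'I_N -> R := fun i => rr (sign (tau - x i)) (b i).

(* [search eta gamma x c t] is the interval (l_(t+1), r_(t+1)), rounds being
   counted from 0; [c t i] is the coin of user i in round t. *)
Fixpoint search (N : nat) (eta gamma : R) (x : 'I_N -> R)
    (c : nat -> 'I_N -> bool) (t : nat) : R * R :=
  if t is t'.+1 then
    let lr := search eta gamma x c t' in
    let tau := mid lr in
    if gamma <= Phi' eta (reports x tau (c t')) then (lr.1, tau)
    else (tau, lr.2)
  else (-1, 1).

Definition transcript (N L : nat) (eps gamma : R) (x : 'I_N -> R)
    (c : nat -> 'I_N -> bool) : 'M[R]_(L, N) :=
  \matrix_(t < L, i < N)
    reports x (mid (search (eps / L%:R) gamma x c t)) (c t) i.

Definition xtilde (N L : nat) (eps gamma : R) (x : 'I_N -> R)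
    (c : nat -> 'I_N -> bool) : R :=
  mid (search (eps / L%:R) gamma x c L).

End Algorithm.

Section Randomness.
Context {R : realType} {d : measure_display} {Omega : measurableType d}
  (P : probability Omega R).

Definition mutually_independent (I : finType) (G : I -> set (set Omega)) :
    Prop :=
  forall (J : {set I}) (E : I -> set Omega),
    (forall k, k \in J -> G k (E k)) ->
    P (\bigcap_(k in [set k | k \in J]) E k) = (\prod_(k in J) P (E k))%E.

Definition coin_law (eta : R) (b : {RV P >-> bool}) : Prop :=
  distribution P b = bernoulli_prob (expR eta / (1 + expR eta)).

Definition fresh_coins (N L : nat) (eps : R)
    (c : nat -> 'I_N -> {RV P >-> bool}) : Prop :=
  (forall (t : 'I_L) (i : 'I_N), coin_law (eps / L%:R) (c t i)) /\
  mutually_independent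
    (fun k : 'I_L * 'I_N => g_sigma_algebra_preimage (c k.1 k.2)).

(* Data drawn i.i.d. from mu; all the coins and all the data are jointly
   independent. Laws are compared on measurable sets only, since a measure is
   unconstrained on the other sets. *)
Definition iid_experiment (N L : nat) (eps : R) (mu : probability R R)
    (X : 'I_N -> {RV P >-> R}) (c : nat -> 'I_N -> {RV P >-> bool}) : Prop :=
  [/\ forall i A, measurable A -> distribution P (X i) A = mu A,
      forall (t : 'I_L) (i : 'I_N), coin_law (eps / L%:R) (c t i)
    & mutually_independent (fun k : 'I_N + 'I_L * 'I_N =>
        match k with
        | inl i => g_sigma_algebra_preimage (X i)
        | inr (t, i) => g_sigma_algebra_preimage (c t i)
        end)].

(* Local differential privacy of the total participation of every user in a
   protocol whose transcript on data x is the random element [M x]. *)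
Definition locally_private (eps : R) (N : nat) (T : Type)
    (M : ('I_N -> R) -> Omega -> T) : Prop :=
  forall (i : 'I_N) (x x' : 'I_N -> R),
    (forall j, -1 <= x j <= 1) -> (forall j, -1 <= x' j <= 1) ->
    (forall j, j != i -> x j = x' j) ->
    forall S : set T,
      (P (M x @^-1` S) <= (expR eps)%:E * P (M x' @^-1` S))%E.

Definition Err (N L : nat) (eps gamma m : R) (X : 'I_N -> Omega -> R)
    (c : nat -> 'I_N -> {RV P >-> bool}) : \bar R :=
  'E_P[fun w => (`|m - xtilde L eps gamma (X^~ w) (fun t i => c t i w)|)%R]%E.

End Randomness.

Definition cdf_on {R : realType} (F : R -> R) (mu : probability R R) : Prop :=
  mu `[-1, 1]%classic = 1%E /\
  (forall x, -1 <= x <= 1 -> mu `]-oo, x]%classic = (F x)%:E).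

Section Asymptotics.
Context {R : realType}.

Definition threshold (eps h : R) (L N : nat) : R :=
  let e := expR (eps / L%:R) in
  Num.sqrt (4 * e * (1 + e) * h / ((e - 1) ^+ 2 * N%:R)).

Definition rate (eps h : R) (L N : nat) : R :=
  L%:R ^+ 2 * h / (eps ^+ 2 * N%:R).

Definition error_bound (alpha eps h : R) (L N : nat) : R :=
  rate eps h L N `^ (1 / (2 * alpha)) + expR (- h) + 2 ^- L.

End Asymptotics.

(* Main.v *)
Require Import Defs.
From HB Require Import structures.
From mathcomp Require Import all_boot all_order all_algebra.
From mathcomp Require Import all_classical all_reals all_analysis.
From mathcomp Require Import measurable_realfun.
From mathcomp Require Import ring lra.

(** The transcript and the output are functions of the data and of the L x N
    coins, and the coins have an explicit product law ([coins_at_law]). Hence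
    both parts of the theorem reduce to weighted sums over finite arrays of
    coins.

    Privacy. Let one datum change, and negate exactly those coins of its owner
    for which the two data give different signs. Every report stays the same,
    hence so does every later threshold tau, and the negations can be undone
    by exchanging the two data: this is a bijection of the coin arrays
    ([flipK]) that preserves the transcript. It changes the weight of an array
    by a factor of at most e^(eps/L) in each round, e^eps in total.

    Accuracy. Put m = xmin and a = m + delta, where delta is a multiple of
    rate^(1/(2 alpha)) large enough for fatness to give F(a) >= 4 gamma
    ([margin_powR], [fat_quantile]). Suppose that no datum lies below m and
    that at least 2 gamma N data lie in [m, a]. Then a turn to the left at some
    tau < m, or to the right at some tau > a, requires the noise in Phi' to
    exceed gamma, which by Hoeffding's inequality has probability at most
    e^(-h) ([wrong_turn_weight], [threshold_noise]); for tau in [m, a] both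
    turns are harmless. A wrong turn in round t carries the search interval
    away from [m, a] by at most its new length 2^-t ([search_drift]). Summing
    over the rounds, wrong turns cost at most 2 e^(-h) in expectation: as the
    possible damage decays geometrically, no factor L arises
    ([finite_error]).

    Fixed data satisfy the two assumptions ([fixed_data_ge_xmin],
    [fixed_data_count]). In the i.i.d. setting they fail with probability at
    most e^(-h), by Hoeffding's inequality for the number of data below a, and
    then the error is at most 2. To fix the data while averaging over the
    coins, one uses that the search only compares the data with finitely many
    dyadic points, so that the data may be replaced by a finite code
    ([iid_condition]). *)

Set Implicit Arguments.
Unset Strict Implicit.
Unset Printing Implicit Defensive.
Import Order.TTheory GRing.Theory Num.Theory.
Import numFieldNormedType.Exports.
Local Open Scope classical_set_scope.
Local Open Scope ring_scope.

(** * Hoeffding's inequality for two-valued variables *)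

Section ExponentialMoments.
Context {R : realType}.
Implicit Types (x a b p q : R).

Lemma leq_exp2_fact k : (2 ^ k * k`! <= (k.*2)`!)%N.
Proof.
elim: k => // k IH; rewrite doubleS !factS expnS.
have -> : (2 * 2 ^ k * (k.+1 * k`!) = k.*2.+2 * (2 ^ k * k`!))%N.
  by rewrite -doubleS -mul2n; ring.
rewrite leq_mul2l /=; apply: leq_trans IH _.
by rewrite leq_pmull.
Qed.

(** Termwise comparison of the two power series: the terms of odd degree
    cancel, and those of degree 2k compare by 2^k k! <= (2k)!. *)
Lemma cosh_le_expR x : expR x + expR (- x) <= 2 * expR (x ^+ 2 / 2).
Proof.
have cv (y : R) := @is_cvg_series_exp_coeff R y.
have E : expR x + expR (- x) =
    limn (series (exp_coeff x) \+ series (exp_coeff (- x))).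
  by rewrite limD.
rewrite E; apply: limr_le; first exact: is_cvgD.
apply: nearW => n.
set u := fun i => exp_coeff x i + exp_coeff (- x) i.
have uE i : u i = if odd i then 0 else 2 * (x ^+ i / i`!%:R).
  rewrite /u /exp_coeff /= exprNn -signr_odd; case: (odd i) => /=.
    by rewrite expr1 mulN1r mulNr subrr.
  by rewrite expr0 mul1r -mulr2n mulr_natl.
have u0 i : 0 <= u i.
  rewrite uE; case: (boolP (odd i)) => // oi.
  by rewrite mulr_ge0// divr_ge0// exprn_even_ge0.
have -> : (series (exp_coeff x) \+ series (exp_coeff (- x))) n =
          \sum_(0 <= i < n) u i.
  by rewrite /series /= -big_split.
apply: (@le_trans _ _ (\sum_(0 <= i < n.*2) u i)).
  have n2 : (n <= n.*2)%N by rewrite -addnn leq_addr.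
  by rewrite [leRHS](big_cat_nat (n := n))//= lerDl sumr_ge0.
apply: (@le_trans _ _ (2 * series (exp_coeff (x ^+ 2 / 2)) n)); last first.
  rewrite ler_pM2l//; apply: nondecreasing_cvgn_le => //.
  apply: nondecreasing_series => i _ _.
  by rewrite exp_coeff_ge0// divr_ge0// sqr_ge0.
rewrite /series /=; elim: n => [|n IH]; first by rewrite !big_nil mulr0.
rewrite doubleS !big_nat_recr//= mulrDr -addrA lerD//.
rewrite !uE /= odd_double /= addr0 ler_pM2l// /exp_coeff /=.
rewrite -mul2n exprM expr_div_n -[leRHS]mulrA ler_wpM2l ?(exprn_ge0 _ (sqr_ge0
  x))//.
rewrite -[leRHS]invfM -natrX -natrM lef_pV2 ?posrE ?ltr0n ?fact_gt0//;
  last first.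
  by rewrite muln_gt0 expn_gt0 fact_gt0.
by rewrite ler_nat mul2n leq_exp2_fact.
Qed.

(** Symmetrization. If Y is the centred two-point variable and Y' an
    independent copy, then E e^(-Y') >= 1 since e^u >= 1 + u, so E e^Y is at
    most E e^(Y - Y') <= (1 + cosh (a - b)) / 2 = cosh ((a - b) / 2) ^ 2, and
    [cosh_le_expR] applies. *)
Lemma two_point_mgf p q a b : 0 <= p -> 0 <= q -> p + q = 1 ->
  p * a + q * b = 0 ->
  p * expR a + q * expR b <= expR ((a - b) ^+ 2 / 4).
Proof.
move=> p0 q0 pq1 mean0.
set S := p * _ + _.
have S0 : 0 <= S by rewrite addr_ge0// mulr_ge0// expR_ge0.
set S' := p * expR (- a) + q * expR (- b).
have S'1 : 1 <= S'.
  have : p * (1 - a) + q * (1 - b) <= S'.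
    by rewrite lerD// ler_wpM2l// expR_ge1Dx.
  lra.
apply: (le_trans (ler_peMr S0 S'1)).
set h := (a - b) / 2.
set c := expR h + expR (- h).
have c2 : 2 <= c by have := expR_ge1Dx h; have := expR_ge1Dx (- h);
  rewrite /c; lra.
have SS : S * S' = 1 + p * q * (c ^+ 2 - 4).
  have ea : expR a * expR (- a) = 1 by rewrite -expRD subrr expR0.
  have eb : expR b * expR (- b) = 1 by rewrite -expRD subrr expR0.
  have eh : expR h * expR (- h) = 1 by rewrite -expRD subrr expR0.
  have hh : h + h = a - b by rewrite /h; field.
  have e1 : expR a * expR (- b) = expR h ^+ 2.
    by rewrite -expRD expr2 -expRD hh.
  have e2 : expR b * expR (- a) = expR (- h) ^+ 2.
    by rewrite -expRD expr2 -expRD -opprD hh opprB.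
  have -> : S * S' = p ^+ 2 * (expR a * expR (- a)) + q ^+ 2 * (expR b * expR
    (- b))
      + p * q * (expR a * expR (- b) + expR b * expR (- a)).
    by rewrite /S /S'; ring.
  rewrite ea eb e1 e2.
  have -> : c ^+ 2 = expR h ^+ 2 + expR (- h) ^+ 2 + 2 * (expR h * expR (- h)).
    by rewrite /c; ring.
  rewrite eh; have -> : q = 1 - p by lra.
  ring.
have pq4 : p * q <= 4^-1.
  have -> : q = 1 - p by lra.
  have := sqr_ge0 (p - 2^-1); lra.
have c24 : 0 <= c ^+ 2 - 4 by nra.
have : S * S' <= (c / 2) ^+ 2.
  rewrite SS expr_div_n.
  have := ler_wpM2r c24 pq4; lra.
move=> /le_trans; apply.
have -> : (a - b) ^+ 2 / 4 = h ^+ 2 / 2 + h ^+ 2 / 2 by rewrite /h; field.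
rewrite expRD -expr2; apply: lerXn2r; rewrite ?nnegrE ?expR_ge0//.
  by lra.
have := cosh_le_expR h; rewrite -/c; lra.
Qed.

End ExponentialMoments.

Section FiniteProbability.
Context {R : realType}.

(** Chernoff's method with [two_point_mgf]. The constant in the exponent is
    half of the optimal one. *)
Lemma hoeffding (I : finType) (w Y : I -> bool -> R) (s : R) :
  (0 < #|I|)%N -> 0 <= s ->
  (forall i b, 0 <= w i b) -> (forall i, w i true + w i false = 1) ->
  (forall i, w i true * Y i true + w i false * Y i false = 0) ->
  (forall i, (Y i true - Y i false) ^+ 2 = 1) ->
  \sum_(v : {ffun I -> bool})
     (\prod_i w i (v i)) * (s <= \sum_i Y i (v i))%R%:R
  <= expR (- (s ^+ 2 / #|I|%:R)).
Proof.
move=> I0 s0 w0 w1 mean0 range1.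
have n0 : 0 < #|I|%:R :> R by rewrite ltr0n.
(* The minimizer of n l^2 / 4 - l s, where n is the number of variables. *)
pose l := 2 * s / #|I|%:R.
have l0 : 0 <= l by rewrite divr_ge0// ?mulr_ge0// ltW.
apply: (@le_trans _ _ (\sum_(v : {ffun I -> bool})
    (\prod_i (w i (v i) * expR (l * Y i (v i)))) * expR (- (l * s)))).
  apply: ler_sum => v _; rewrite big_split /= -mulrA.
  apply: ler_wpM2l; first by apply: prodr_ge0.
  rewrite -expR_sum -mulr_sumr -expRD -mulrBr.
  case: (lerP s (\sum_i Y i (v i))) => sY /=; last exact: expR_ge0.
  rewrite -[leLHS]expR0 ler_expR mulr_ge0// subr_ge0//.
rewrite -mulr_suml -(bigA_distr_bigA (fun i b => w i b * expR (l * Y i b))).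
apply: (@le_trans _ _ ((\prod_(i : I) expR (l ^+ 2 / 4)) * expR (- (l * s)))).
  apply: ler_wpM2r; first exact: expR_ge0.
  apply: ler_prod => i _; apply/andP; split.
    by apply: sumr_ge0 => b _; rewrite mulr_ge0// expR_ge0.
  rewrite big_bool /=.
  apply: le_trans (two_point_mgf _ _ _ _) _ => //.
    by rewrite !(mulrCA _ l) -mulrDr mean0 mulr0.
  by rewrite -mulrBr exprMn range1 mulr1.
rewrite prodr_const -expRM_natr -expRD ler_expR /l.
by rewrite le_eqVlt; apply/orP; left; apply/eqP; field; rewrite gt_eqF.
Qed.

(** Redrawing one coordinate of an independent family leaves its law
    unchanged: the map that exchanges the old coordinate with the new one
    preserves the weights. It serves to average over the coins of one round
    while all the other rounds are kept. *)
Lemma resample (I T : finType) (W : T -> R) (f : {ffun I -> T} -> R) (t : I) :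
  \sum_v W v = 1 ->
  \sum_(b : {ffun I -> T}) (\prod_s W (b s)) * f b =
  \sum_(b : {ffun I -> T}) (\prod_s W (b s)) *
     \sum_v W v * f [ffun s => if s == t then v else b s].
Proof.
move=> W1; pose upd (b : {ffun I -> T}) v := [ffun s => if s == t then v else
  b s].
have -> : \sum_(b : {ffun I -> T}) (\prod_s W (b s)) * f b =
    \sum_(p : {ffun I -> T} * T) (\prod_s W (p.1 s)) * W p.2 * f p.1.
  rewrite -(pair_bigA _ (fun (b : {ffun I -> T}) v => (\prod_s W (b s)) * W v
    * f b)) /=.
  apply: eq_bigr => b _; rewrite -mulr_suml -mulr_sumr W1 mulr1 //.
pose swap (p : {ffun I -> T} * T) := (upd p.1 p.2, p.1 t).
have swapK : involutive swap.
  move=> [b v]; rewrite /swap /upd /=; congr pair; last by rewrite ffunE eqxx.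
  by apply/ffunP => s; rewrite !ffunE; case: eqP => // ->.
rewrite (reindex_inj (inv_inj swapK)) /=.
rewrite -(pair_bigA _ (fun (b : {ffun I -> T}) v => (\prod_s W (upd b v s)) *
  W (b t) * f (upd b v))) /=.
apply: eq_bigr => b _; rewrite mulr_sumr; apply: eq_bigr => v _.
rewrite mulrA; congr (_ * _).
rewrite (bigD1 t)//= [in RHS](bigD1 t)//= ffunE eqxx.
rewrite (eq_bigr (fun s => W (b s))); first by ring.
by move=> s /negPf st; rewrite ffunE st.
Qed.

End FiniteProbability.

(** * Coins and their weights *)

(** Grouped by rounds, so that [resample] can redraw a whole round at once. *)
Notation coin_array L N := {ffun 'I_L -> {ffun 'I_N -> bool}} (only parsing).

Section Coins.
Context {R : realType}.
Implicit Type eta : R.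

Definition coin_weight eta (b : bool) : R :=
  (if b then expR eta else 1) / (1 + expR eta).

Lemma coin_weight_ge0 eta b : 0 <= coin_weight eta b.
Proof.
by rewrite divr_ge0//; case: b; rewrite ?addr_ge0 ?expR_ge0.
Qed.

Lemma coin_weight_sum eta : coin_weight eta true + coin_weight eta false = 1.
Proof.
by rewrite /coin_weight -mulrDl addrC divff// gt_eqF// addr_gt0// expR_gt0.
Qed.

Lemma coin_weight_le eta b b' : 0 <= eta ->
  coin_weight eta b <= expR eta * coin_weight eta b'.
Proof.
move=> eta0; rewrite /coin_weight mulrA ler_wpM2r ?invr_ge0 ?addr_ge0
  ?expR_ge0//.
have e1 : 1 <= expR eta by rewrite -expR0 ler_expR.
case: b; case: b'; rewrite ?mulr1//.
  by rewrite ler_peMr// expR_ge0.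
by rewrite mulr_ege1.
Qed.

Definition round_weight (N : nat) eta (v : {ffun 'I_N -> bool}) : R :=
  \prod_i coin_weight eta (v i).

Definition coins_weight (L N : nat) eta
    (b : coin_array L N) : R :=
  \prod_t round_weight eta (b t).

(** Extends an array to all natural numbers, as [search] requires. *)
Definition coins_of (L N : nat) (b : coin_array L N) :
    nat -> 'I_N -> bool :=
  fun t i => if insub t is Some s then b s i else false.

Lemma coins_ofE (L N : nat) (b : coin_array L N)
  (t : 'I_L) : coins_of b t = b t.
Proof. by apply/funext => i; rewrite /coins_of valK. Qed.

Lemma round_weight_ge0 N eta (v : {ffun 'I_N -> bool}) : 0 <= round_weight eta
  v.
Proof. by apply: prodr_ge0 => i _; exact: coin_weight_ge0. Qed.

Lemma coins_weight_ge0 L N eta (b : coin_array L N) :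
  0 <= coins_weight eta b.
Proof. by apply: prodr_ge0 => i _; exact: round_weight_ge0. Qed.

Lemma round_weight_sum N eta :
  \sum_(v : {ffun 'I_N -> bool}) round_weight eta v = 1.
Proof.
rewrite -(bigA_distr_bigA (fun=> coin_weight eta)) big1// => i _.
by rewrite big_bool /= coin_weight_sum.
Qed.

Lemma coins_weight_sum L N eta :
  \sum_(b : coin_array L N) coins_weight eta b = 1.
Proof.
rewrite -(bigA_distr_bigA (fun=> @round_weight N eta)) big1// => i _.
by rewrite round_weight_sum.
Qed.

End Coins.

(** * The dyadic search *)

Section Search.
Context {R : realType}.
Variables (N : nat) (eta gamma : R).
Implicit Types (x : 'I_N -> R) (c : nat -> 'I_N -> bool) (t : nat).

Lemma sign_le (tau a : R) : sign (tau - a) = if a <= tau then 1 else -1.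
Proof. by rewrite /sign subr_ge0. Qed.

Lemma eq_search x c c' t : (forall s i, (s < t)%N -> c s i = c' s i) ->
  search eta gamma x c t = search eta gamma x c' t.
Proof.
elim: t => //= t IH cc'; rewrite IH; last by move=> s i st;
  rewrite cc'// ltnS ltnW.
by have -> : c t = c' t by apply/funext => i; rewrite cc'.
Qed.

(** The endpoints of the intervals that can occur before round t. *)
Definition node t (j : nat) : R := -1 + 2 * j%:R / 2 ^+ t.

Lemma mid_node t j : mid (node t j, node t j.+1) = node t.+1 j.*2.+1.
Proof.
rewrite /mid /node /= exprS -[j.*2.+1]addn1 -muln2 -[j.+1]addn1 !natrD natrM.
by field; rewrite expf_neq0.
Qed.

Lemma node_double t j : node t.+1 j.*2 = node t j.
Proof.
rewrite /node exprS -muln2 natrM.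
by field; rewrite expf_neq0.
Qed.

Lemma node_scale t s j : node (t + s) (j * 2 ^ s)%N = node t j.
Proof.
elim: s => [|s IH]; first by rewrite addn0 muln1.
by rewrite addnS expnS mulnCA mul2n node_double.
Qed.

Lemma search_node x c t : exists2 j, (j < 2 ^ t)%N &
  search eta gamma x c t = (node t j, node t j.+1).
Proof.
elim: t => [|t [j jt E]].
  by exists 0%N => //; rewrite /= /node; congr pair; field.
rewrite /= E mid_node; case: ifP => _ /=.
  exists j.*2; last by rewrite node_double.
  by rewrite expnS mul2n ltn_double.
exists j.*2.+1; first by rewrite expnS mul2n ltn_Sdouble.
by rewrite -doubleS node_double.
Qed.

(** A single grid contains the thresholds of all the L rounds. *)
Lemma mid_search_node x c t L : (t < L)%N ->
  exists2 j, (j < 2 ^ L)%N & mid (search eta gamma x c t) = node L j.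
Proof.
move=> tL; have [j jt ->] := search_node x c t.
exists (j.*2.+1 * 2 ^ (L - t.+1))%N.
  rewrite -[X in (_ < 2 ^ X)%N](subnKC tL) expnD ltn_pmul2r ?expn_gt0//.
  by rewrite expnS mul2n ltn_Sdouble.
by rewrite mid_node -(node_scale t.+1 (L - t.+1)) subnKC.
Qed.

Lemma node_bounds t j : (j <= 2 ^ t)%N -> -1 <= node t j <= 1.
Proof.
move=> jt; rewrite /node; apply/andP; split.
  by rewrite lerDl !mulr_ge0// invr_ge0 exprn_ge0.
have e0 : 0 < 2 ^+ t :> R by rewrite exprn_gt0.
suff : 2 * j%:R / 2 ^+ t <= 2 :> R by lra.
by rewrite ler_pdivrMr// ler_pM2l// -natrX ler_nat.
Qed.

Lemma mid_search_bounds x c t : -1 <= mid (search eta gamma x c t) <= 1.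
Proof.
by have [j jt ->] := mid_search_node x c (ltnSn t); rewrite node_bounds// ltnW.
Qed.

(** The data enter only through their comparisons with the finitely many
    nodes of depth L; this is what makes a finite coding of the data
    possible. *)
Lemma eq_search_data L x x' c t : (t <= L)%N ->
  (forall i j, (j < 2 ^ L)%N -> (x i <= node L j) = (x' i <= node L j)) ->
  search eta gamma x c t = search eta gamma x' c t.
Proof.
move=> tL xx'; elim: t tL => //= t IH tL; rewrite IH ?(ltnW tL)//.
have -> // : reports x (mid (search eta gamma x' c t)) (c t) =
             reports x' (mid (search eta gamma x' c t)) (c t).
apply/funext => i; rewrite /reports !sign_le.
by have [j jL ->] := mid_search_node x' c tL; rewrite xx'.
Qed.

End Search.

(** * Local differential privacy, on arrays of coins *)

Section Privacy.
Context {R : realType}.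
Variables (N L : nat) (eta gamma : R).
Implicit Types (x : 'I_N -> R) (b : coin_array L N).

(** Negates the coins for which x and x' give different signs at the thresholds
    of the run on x, so that the run on x' makes the same reports. *)
Definition flip x x' b : coin_array L N :=
  [ffun t : 'I_L => [ffun i =>
    let tau := mid (search eta gamma x (coins_of b) t) in
    b t i (+) (sign (tau - x i) != sign (tau - x' i))]].

Lemma rr_flip (tau a a' : R) c :
  rr (sign (tau - a')) (c (+) (sign (tau - a) != sign (tau - a'))) =
  rr (sign (tau - a)) c.
Proof.
have n1 : (1 == -1 :> R) = false by apply/eqP; lra.
have n2 : (-1 == 1 :> R) = false by apply/eqP; lra.
by rewrite /rr !sign_le; case: c; case: (a <= tau); case: (a' <= tau);
  rewrite ?eqxx ?n1 ?n2 //= ?opprK.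
Qed.

Lemma reports_flip x x' b (t : 'I_L) :
  let tau := mid (search eta gamma x (coins_of b) t) in
  reports x' tau (flip x x' b t) = reports x tau (b t).
Proof.
by apply/funext => i; rewrite /reports !ffunE rr_flip.
Qed.

Lemma search_flip x x' b t : (t <= L)%N ->
  search eta gamma x' (coins_of (flip x x' b)) t =
  search eta gamma x (coins_of b) t.
Proof.
elim: t => //= t IH tL; rewrite IH ?(ltnW tL)//.
have := reports_flip x x' b (Ordinal tL).
by rewrite -!(coins_ofE _ (Ordinal tL)) /= => ->.
Qed.

(** The run on x' with flipped coins visits the same thresholds, hence the
    flip from x' to x negates the same coins again. *)
Lemma flipK x x' : cancel (flip x x') (flip x' x).
Proof.
move=> b; apply/ffunP => t; apply/ffunP => i; rewrite !ffunE search_flip;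
  last exact: ltnW.
by rewrite /= [sign (_ - x' i) == _]eq_sym addbK.
Qed.

(** Only the coin of user i can be negated, and the two weights of a coin have
    ratio e^eta. *)
Lemma round_weight_flip x x' b (t : 'I_L) i : 0 <= eta ->
  (forall j, j != i -> x j = x' j) ->
  round_weight eta (b t) <= expR eta * round_weight eta (flip x x' b t).
Proof.
move=> eta0 xx'; rewrite /round_weight (bigD1 i)//= [in leRHS](bigD1 i)//=
  mulrA.
rewrite (@eq_bigr _ _ _ _ _ _ (fun j => coin_weight eta (flip x x' b t j))
  (fun j => coin_weight eta (b t j))); last first.
  by move=> j ji; rewrite !ffunE xx'//= eqxx addbF.
apply: ler_wpM2r; last exact: coin_weight_le.
by apply: prodr_ge0 => j _; exact: coin_weight_ge0.
Qed.

End Privacy.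

(** For f the indicator of a set of transcripts this is the required bound;
    it follows by reindexing along [flip], whose cost e^(eps/L) per round
    multiplies up to e^eps. *)
Lemma finite_privacy (R : realType) (N L : nat) (eps gamma : R)
    (x x' : 'I_N -> R) (i : 'I_N) (f : 'M[R]_(L, N) -> R) :
  (0 < L)%N -> 0 <= eps -> (forall j, j != i -> x j = x' j) ->
  (forall z, 0 <= f z) ->
  \sum_(b : coin_array L N)
     coins_weight (eps / L%:R) b * f (transcript L eps gamma x (coins_of b))
  <= expR eps * \sum_(b : coin_array L N)
     coins_weight (eps / L%:R) b * f (transcript L eps gamma x' (coins_of b)).
Proof.
move=> L0 eps0 xx' f0; set eta := eps / L%:R.
have eta0 : 0 <= eta by rewrite divr_ge0.
rewrite [in leRHS](reindex_inj (can_inj (flipK eta gamma x x'))) mulr_sumr.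
apply: ler_sum => b _; rewrite mulrA.
have -> : transcript L eps gamma x' (coins_of (flip eta gamma x x' b)) =
          transcript L eps gamma x (coins_of b).
  apply/matrixP => t j; rewrite !mxE -/eta search_flip; last exact: ltnW.
  by rewrite !coins_ofE reports_flip.
apply: ler_wpM2r => //; rewrite /coins_weight.
have -> : expR eps = \prod_(t < L) expR eta.
  rewrite prodr_const card_ord -expRM_natr /eta divfK//.
  by rewrite pnatr_eq0 -lt0n.
rewrite -big_split /=; apply: ler_prod => t _.
by rewrite round_weight_ge0 (round_weight_flip _ _ _ eta0 xx').
Qed.

(** * Wrong turns and their probability *)

Section Accuracy.
Context {R : realType}.
Variables (N : nat) (eta gamma m a : R) (x : 'I_N -> R).
Implicit Types (c : nat -> 'I_N -> bool) (t : nat) (tau : R).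

(** Only these turns can separate the search interval from [m, a]. *)
Definition wrong_turn tau (v : 'I_N -> bool) : bool :=
  ((tau < m) && (gamma <= Phi' eta (reports x tau v))) ||
  ((a < tau) && (Phi' eta (reports x tau v) < gamma)).

(** Bounds how far the wrong turns before round t have carried the search
    interval away from [m, a]. *)
Definition drift c t : R :=
  \sum_(s < t) (wrong_turn (mid (search eta gamma x c s)) (c s))%:R / 2 ^+ s.

Lemma drift_ge0 c t : 0 <= drift c t.
Proof. by apply: sumr_ge0 => s _; rewrite divr_ge0// exprn_ge0. Qed.

(** A correct turn, or any turn at a threshold in [m, a], replaces an endpoint
    by a point on the permitted side of [m, a]; a wrong one moves an endpoint
    by half the length 2^(1-t) of the interval. *)
Lemma search_drift c t : -1 <= m <= 1 -> m <= a ->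
  let lr := search eta gamma x c t in
  [/\ lr.2 - lr.1 = 2 / 2 ^+ t, lr.1 <= a + drift c t & m - drift c t <= lr.2].
Proof.
move=> /andP[m1 m2] ma; elim: t => [|t].
  by rewrite /drift big_ord0 /= expr0; split; lra.
have d0 := drift_ge0 c t; rewrite /drift big_ord_recr /= -/(drift c t).
set lr := search _ _ _ _ _; move=> [width left right].
have [e0 e1] : 0 < (2 ^+ t)^-1 :> R /\ (2 ^+ t.+1)^-1 = (2 ^+ t)^-1 / 2 :> R.
  by rewrite invr_gt0 exprn_gt0// exprS invfM mulrC.
move: width; rewrite e1; move: ((2 ^+ t)^-1) e0 => e e0 width.
rewrite /wrong_turn; set tau := mid lr.
have tauE : tau = (lr.1 + lr.2) / 2 by [].
case: (lerP gamma) => go; rewrite ?andbT ?andbF ?orbF /=.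
  by case: (ltrP tau m) => tm /=; split; lra.
by case: (ltrP a tau) => tm /=; split; lra.
Qed.

Lemma xtilde_error c L : -1 <= m <= 1 -> m <= a ->
  `|m - mid (search eta gamma x c L)| <= (a - m) + 2 ^- L + drift c L.
Proof.
move=> m11 ma; have := search_drift c L m11 ma.
rewrite /mid; set lr := search _ _ _ _ _ => -[].
move: ((2 ^+ L)^-1) => e width left right.
have := drift_ge0 c L.
move=> ?; rewrite ler_norml; apply/andP; split; lra.
Qed.

(** Half of a report minus its mean, so that its two values differ by 1 up to
    sign, as [hoeffding] requires. *)
Definition centred_report tau (i : 'I_N) (b : bool) : R :=
  (rr (sign (tau - x i)) b
   - sign (tau - x i) * ((expR eta - 1) / (expR eta + 1))) / 2.

Lemma rrE (s : R) b : rr s b = s * (if b then 1 else -1).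
Proof. by case: b; rewrite /= ?mulr1 ?mulrN1. Qed.

Lemma sqr_sign (y : R) : sign y ^+ 2 = 1.
Proof. by rewrite /sign; case: ifP; rewrite ?sqrrN expr1n. Qed.

Lemma centred_report_mean tau i :
  coin_weight eta true * centred_report tau i true +
  coin_weight eta false * centred_report tau i false = 0.
Proof.
have := expR_gt0 eta; rewrite /centred_report /coin_weight !rrE => e0.
by field; lra.
Qed.

Lemma centred_report_range tau i :
  (centred_report tau i true - centred_report tau i false) ^+ 2 = 1.
Proof.
have := expR_gt0 eta => e0.
rewrite -[RHS](sqr_sign (tau - x i)); congr (_ ^+ 2).
by rewrite /centred_report !rrE; field; lra.
Qed.

(** Phi' is the fraction of the data that are at most tau plus a centred
    noise: the factor (e^eta + 1) / (e^eta - 1) undoes the bias of randomized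
    response. *)
Lemma Phi'_split tau (v : 'I_N -> bool) : (0 < N)%N -> 0 < eta ->
  Phi' eta (reports x tau v) =
    ((\sum_i sign (tau - x i)) / (2 * N%:R) + 2^-1)
    + (expR eta + 1) / (expR eta - 1) / N%:R * \sum_i centred_report tau i (v
      i).
Proof.
move=> N0 eta0; have e1 : 1 < expR eta by rewrite expR_gt1.
have N0' : N%:R != 0 :> R by rewrite pnatr_eq0 -lt0n.
rewrite /Phi' /centred_report -mulr_suml sumrB -mulr_suml /reports.
field; rewrite N0' /=; lra.
Qed.

(** At tau < m the fraction of data at most tau is 0, at tau > a it is at
    least 2 gamma; in both cases a wrong turn needs noise of size gamma. *)
Lemma wrong_turn_weight tau : (0 < N)%N -> 0 < eta -> 0 <= gamma -> m <= a ->
  (forall i, m <= x i) ->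
  2 * gamma * N%:R <= \sum_i (x i <= a)%R%:R ->
  \sum_(v : {ffun 'I_N -> bool}) round_weight eta v * (wrong_turn tau v)%:R
  <= expR (- ((gamma * N%:R * ((expR eta - 1) / (expR eta + 1))) ^+ 2 / N%:R)).
Proof.
move=> N0 eta0 gamma0 ma mx cnt.
have e1 : 1 < expR eta by rewrite expR_gt1.
have N0' : 0 < N%:R :> R by rewrite ltr0n.
set s := gamma * _ * _.
have s0 : 0 <= s by rewrite !mulr_ge0// ?divr_ge0//; lra.
have hoeff (Y : 'I_N -> bool -> R) :
    (forall i, coin_weight eta true * Y i true + coin_weight eta false * Y i
      false = 0) ->
    (forall i, (Y i true - Y i false) ^+ 2 = 1) ->
    (forall v : {ffun 'I_N -> bool}, wrong_turn tau v -> s <= \sum_i Y i (v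
      i)) ->
    \sum_(v : {ffun 'I_N -> bool}) round_weight eta v * (wrong_turn tau v)%:R
    <= expR (- (s ^+ 2 / N%:R)).
  move=> Y0 Y1 Ys; have := @hoeffding R 'I_N (fun=> coin_weight eta) Y s.
  rewrite card_ord => /(_ N0 s0) H; apply: le_trans (H _ _ _ _) => //.
  - apply: ler_sum => v _; apply: ler_wpM2l; first exact: round_weight_ge0.
    by rewrite ler_nat; case: (boolP (wrong_turn tau v)) => // /Ys ->.
  - by move=> *; exact: coin_weight_ge0.
  - by move=> *; exact: coin_weight_sum.
set k := (expR eta + 1) / (expR eta - 1).
have k0 : 0 < k by rewrite divr_gt0//; lra.
have ks : k / N%:R * s = gamma.
  by rewrite /s /k; field; rewrite !gt_eqF//; lra.
have kN0 : 0 < k / N%:R by rewrite divr_gt0.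
case: (ltrP tau m) => tm.
  apply: (hoeff (centred_report tau)) => [i|i|v].
  - exact: centred_report_mean.
  - exact: centred_report_range.
  rewrite /wrong_turn tm /= ltNge (ltW (lt_le_trans tm ma)) /= orbF
    Phi'_split//.
  rewrite (eq_bigr (fun=> -1)); last first.
    by move=> i _; rewrite sign_le leNgt (lt_le_trans tm (mx i)).
  rewrite sumr_const card_ord -/k.
  have -> : (- 1 *+ N) / (2 * N%:R) + 2^-1 = 0 :> R.
    by rewrite -[_ *+ _]mulr_natr; field; rewrite gt_eqF.
  by rewrite add0r -ks ler_pM2l.
case: (ltrP a tau) => ta; last first.
  rewrite big1 ?expR_ge0// => v _.
  by rewrite /wrong_turn ltNge tm [a < tau]ltNge ta /= mulr0.
apply: (hoeff (fun i b => - centred_report tau i b)) => [i|i|v].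
- by rewrite !mulrN -opprD centred_report_mean oppr0.
- by rewrite -opprD sqrrN centred_report_range.
rewrite /wrong_turn ltNge tm ta /= Phi'_split// -/k sumrN => lt_gamma.
have S : 4 * gamma * N%:R - N%:R <= \sum_i sign (tau - x i).
  apply: (@le_trans _ _ (\sum_(i < N) (2 * (x i <= a)%R%:R - 1))).
    rewrite sumrB -mulr_sumr sumr_const card_ord; lra.
  apply: ler_sum => i _; rewrite sign_le.
  case: (lerP (x i) a) => xa /=; last by case: ifP; lra.
  by rewrite (le_trans xa (ltW ta)); lra.
have : 2 * gamma <= (\sum_i sign (tau - x i)) / (2 * N%:R) + 2^-1.
  rewrite -lerBlDr ler_pdivlMr ?mulr_gt0//.
  by apply: le_trans S; rewrite le_eqVlt; apply/orP; left; apply/eqP; field.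
move=> big; rewrite -(ler_pM2l kN0) ks mulrN; lra.
Qed.

End Accuracy.

(** * Expected error over the coins *)

Section ExpectedError.
Context {R : realType}.

Lemma geometric_half (L : nat) : \sum_(t < L) (2 ^+ t)^-1 <= 2 :> R.
Proof.
suff -> : \sum_(t < L) (2 ^+ t)^-1 = 2 - 2 * (2 ^+ L)^-1 :> R.
  by rewrite gerBl mulr_ge0// invr_ge0 exprn_ge0.
elim: L => [|L IH]; first by rewrite big_ord0 expr0; field.
by rewrite big_ord_recr /= IH exprS; field; rewrite expf_neq0.
Qed.

(** The threshold of round t depends on the earlier coins only, so redrawing the
    coins of round t bounds the weight of a wrong turn there by q. *)
Lemma finite_error (N L : nat) (eps gamma m a : R) (x : 'I_N -> R) (q : R) :
  -1 <= m <= 1 -> m <= a ->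
  (forall tau, \sum_(v : {ffun 'I_N -> bool}) round_weight (eps / L%:R) v *
     (wrong_turn (eps / L%:R) gamma m a x tau v)%:R <= q) ->
  \sum_(b : coin_array L N)
     coins_weight (eps / L%:R) b * `|m - xtilde L eps gamma x (coins_of b)|
  <= (a - m) + 2 ^- L + 2 * q.
Proof.
move=> m11 ma wrongq; set eta := eps / L%:R in wrongq *.
have q0 : 0 <= q.
  apply: le_trans (wrongq 0); apply: sumr_ge0 => v _.
  by rewrite mulr_ge0// round_weight_ge0.
pose wrong (b : coin_array L N) (t : 'I_L) : R :=
  (wrong_turn eta gamma m a x (mid (search eta gamma x (coins_of b) t)) (b
    t))%:R.
have wrong_le t : \sum_b coins_weight eta b * wrong b t <= q.
  rewrite /coins_weight (resample _ t (round_weight_sum N eta)).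
  have {1}-> : q = \sum_b @coins_weight R L N eta b * q.
    by rewrite -mulr_suml coins_weight_sum mul1r.
  apply: ler_sum => b _; rewrite -/(coins_weight eta b).
  apply: ler_wpM2l; first exact: coins_weight_ge0.
  apply: le_trans (wrongq (mid (search eta gamma x (coins_of b) t))).
  rewrite le_eqVlt; apply/orP; left; apply/eqP; apply: eq_bigr => v _.
  rewrite /wrong ffunE eqxx; congr (_ * (wrong_turn _ _ _ _ _ (mid _) _)%:R).
  apply: eq_search => s i st; rewrite /coins_of.
  case: insubP => // u _ us; rewrite ffunE.
  by case: eqP => // ut; move: st; rewrite -us ut ltnn.
apply: (@le_trans _ _ (\sum_b coins_weight eta b *
    ((a - m) + 2 ^- L + \sum_(t < L) wrong b t / 2 ^+ t))).
  apply: ler_sum => b _; apply: ler_wpM2l; first exact: coins_weight_ge0.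
  apply: le_trans (xtilde_error eta gamma x (coins_of b) L m11 ma) _.
  rewrite lerD2l /drift; apply: ler_sum => t _.
  by rewrite /wrong coins_ofE.
under eq_bigr do rewrite mulrDr.
rewrite big_split /= -mulr_suml coins_weight_sum mul1r lerD2l.
under eq_bigr do rewrite mulr_sumr.
rewrite exchange_big /=.
apply: (@le_trans _ _ (\sum_(t < L) (2 ^+ t)^-1 * q)).
  apply: ler_sum => t _.
  under eq_bigr do rewrite mulrA.
  by rewrite -mulr_suml mulrC ler_pM2l ?wrong_le// invr_gt0 exprn_gt0.
by rewrite -mulr_suml ler_wpM2r// geometric_half.
Qed.

(** With e = e^(eps/L), the right-hand side equals 4 e h / (e + 1), and
    e >= 1. *)
Lemma threshold_noise (eps h : R) (L N : nat) :
  (0 < L)%N -> (0 < N)%N -> 0 < eps -> 0 < h ->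
  h <= (threshold eps h L N * N%:R *
        ((expR (eps / L%:R) - 1) / (expR (eps / L%:R) + 1))) ^+ 2 / N%:R.
Proof.
move=> L0 N0 eps0 h0; set e := expR _.
have e1 : 1 < e by rewrite expR_gt1 divr_gt0// ltr0n.
have N0' : 0 < N%:R :> R by rewrite ltr0n.
have e2 : 0 < (e - 1) ^+ 2 by rewrite exprn_gt0//; lra.
rewrite /threshold -/e !exprMn exprVn sqr_sqrtr; last first.
  by rewrite divr_ge0 ?mulr_ge0//; lra.
have -> : 4 * e * (1 + e) * h / ((e - 1) ^+ 2 * N%:R) * N%:R ^+ 2 *
   ((e - 1) ^+ 2 / (e + 1) ^+ 2) / N%:R = h * (4 * e / (e + 1)).
  by field; apply/and3P; split; rewrite ?gt_eqF//; lra.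
rewrite ler_pMr// ler_pdivlMr; lra.
Qed.

End ExpectedError.

(** * Finite-valued random elements and the law of the coins *)

Section FiniteValued.
Context {R : realType} {d : measure_display} {Omega : measurableType d}.
Context (P : probability Omega R) (T : finType) (Y : Omega -> T).
Hypothesis mY : forall y, measurable (Y @^-1` [set y]).

Lemma measurable_finite_preimage (A : set T) : measurable (Y @^-1` A).
Proof.
have -> : Y @^-1` A = \bigcup_(y in A) (Y @^-1` [set y]).
  by apply/seteqP; split=> [w Aw|w [y Ay /= ->//]]; exists (Y w).
by apply: fin_bigcup_measurable => // ; exact: finite_finset.
Qed.

Lemma finite_expectation (f : T -> R) : (forall y, 0 <= f y) ->
  ('E_P[f \o Y] = \sum_y (f y)%:E * P (Y @^-1` [set y]))%E.
Proof.
move=> f0; rewrite unlock.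
transitivity (\int[P]_w (\sum_(y : T) (f y)%:E * (\1_(Y @^-1` [set y])
  w)%:E))%E.
  apply: eq_integral => w _; rewrite (bigD1 (Y w))//= big1 ?adde0.
    by rewrite indicE mem_set// mule1.
  by move=> y yY; rewrite indicE memNset ?mule0// => /= yE;
    rewrite yE eqxx in yY.
rewrite ge0_integral_sum//; last first.
- by move=> y w _; rewrite mule_ge0// lee_fin.
- move=> y; apply: measurable_funeM.
  by apply/measurable_EFinP; exact: measurable_indic.
apply: eq_bigr => y _.
rewrite ge0_integralZl_EFin//; last first.
  by apply/measurable_EFinP; exact: measurable_indic.
by rewrite integral_indic// setIT.
Qed.

Lemma finite_probability (A : set T) :
  P (Y @^-1` A) = (\sum_y ((y \in A)%:R : R)%:E * P (Y @^-1` [set y]))%E.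
Proof.
rewrite -expectation_indic; last exact: measurable_finite_preimage.
by rewrite -(finite_expectation (f := fun y => (y \in A)%:R)).
Qed.

End FiniteValued.

Section CoinLaw.
Context {R : realType} {d : measure_display} {Omega : measurableType d}.
Context (P : probability Omega R).

Lemma coin_lawE eta (b : {RV P >-> bool}) v : coin_law eta b ->
  P (b @^-1` [set v]) = (coin_weight eta v)%:E.
Proof.
move=> bl; have e0 := expR_gt0 eta.
have -> : P (b @^-1` [set v]) = distribution P b [set v] by [].
rewrite bl bernoulli_probE; last first.
  rewrite divr_ge0//= ?ler_pdivrMr; lra.
rewrite /coin_weight /unstable.onem; case: v; rewrite !diracE.
  by rewrite mem_set// memNset// mule1 mule0 adde0.
rewrite memNset// mem_set// mule1 mule0 add0e; congr EFin.
by field; lra.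
Qed.

Variables (N L : nat) (c : nat -> 'I_N -> {RV P >-> bool}).

Definition coins_at (w : Omega) : coin_array L N :=
  [ffun t : 'I_L => [ffun i => c t i w]].

Lemma coins_at_preimage b : coins_at @^-1` [set b] =
  \bigcap_(k in [set: 'I_L * 'I_N]) (c k.1 k.2 @^-1` [set b k.1 k.2]).
Proof.
apply/seteqP; split => w /=.
  by move=> <- [t i] _ /=; rewrite !ffunE.
move=> H; apply/ffunP => t; apply/ffunP => i; rewrite !ffunE.
exact: (H (t, i)).
Qed.

Lemma measurable_coins_at b : measurable (coins_at @^-1` [set b]).
Proof.
rewrite coins_at_preimage; apply: fin_bigcap_measurable;
  first exact: finite_finset.
by move=> k _; exact: measurable_funPTI.
Qed.

Lemma coins_at_law eps b : fresh_coins L eps c ->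
  P (coins_at @^-1` [set b]) = (coins_weight (eps / L%:R) b)%:E.
Proof.
move=> [law indep]; rewrite coins_at_preimage.
have := indep [set: _]%SET (fun k => c k.1 k.2 @^-1` [set b k.1 k.2]).
rewrite (_ : [set k | k \in [set: 'I_L * 'I_N]%SET] = setT); last first.
  by apply/seteqP; split => // k _ /=; rewrite inE.
move=> ->; last first.
  by move=> k _; exists [set b k.1 k.2] => //; rewrite setTI.
rewrite /coins_weight /round_weight pair_bigA /= -prodEFin.
rewrite (eq_bigl xpredT); last by move=> k; rewrite inE.
by apply: eq_bigr => -[t i] _ /=; rewrite (coin_lawE _ (law t i)).
Qed.

Lemma search_coins_at (eta gamma : R) x w t : (t <= L)%N ->
  search eta gamma x (fun t i => c t i w) t =
  search eta gamma x (coins_of (coins_at w)) t.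
Proof.
move=> tL; apply: eq_search => s i st.
by rewrite (coins_ofE _ (Ordinal (leq_trans st tL))) !ffunE.
Qed.

End CoinLaw.

(** The first part of the theorem: events about the transcript are events about
    the array of coins, for which [finite_privacy] applies. *)
Lemma fresh_coins_private (R : realType) (N L : nat) (eps gamma : R)
    (d : measure_display) (Omega : measurableType d) (P : probability Omega R)
    (c : nat -> 'I_N -> {RV P >-> bool}) :
  (0 < L)%N -> 0 < eps -> fresh_coins L eps c ->
  locally_private P eps
    (fun x w => transcript L eps gamma x (fun t i => c t i w)).
Proof.
move=> L0 eps0 fc i x x' _ _ xx' S.
have trE y w : transcript L eps gamma y (fun t i => c t i w) =
    transcript L eps gamma y (coins_of (coins_at L c w)).
  apply/matrixP => t j; rewrite !mxE (search_coins_at (L := L));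
    last exact: ltnW.
  by rewrite /reports coins_ofE !ffunE.
have PE y : P ((fun w => transcript L eps gamma y (fun t i => c t i w)) @^-1` S)
    = (\sum_(b : coin_array L N)
         coins_weight (eps / L%:R) b *
         (transcript L eps gamma y (coins_of b) \in S)%:R)%:E.
  under eq_fun do rewrite trE.
  rewrite -[X in P X]/(coins_at L c @^-1`
    ((fun b => transcript L eps gamma y (coins_of b)) @^-1` S)).
  rewrite finite_probability; last exact: measurable_coins_at.
  under eq_bigr do rewrite (coins_at_law _ fc) -EFinM mulrC.
  by rewrite sumEFin.
rewrite !PE -EFinM lee_fin.
exact: (finite_privacy (f := fun z => (z \in S)%:R) _ L0 (ltW eps0) xx').
Qed.

(** * Conditioning on i.i.d. data *)

Section IidLaw.
Context {R : realType} {d : measure_display} {Omega : measurableType d}.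
Context (P : probability Omega R) (N L : nat) (eps : R) (mu : probability R R).
Context (X : 'I_N -> {RV P >-> R}) (c : nat -> 'I_N -> {RV P >-> bool}).
Hypothesis exp : iid_experiment L eps mu X c.

Lemma iid_data_law (A : 'I_N -> set R) : (forall i, measurable (A i)) ->
  P (\bigcap_(i in [set: 'I_N]) (X i @^-1` A i)) = (\prod_i mu (A i))%E.
Proof.
move=> mA; case: exp => law _ indep.
pose J : {set 'I_N + 'I_L * 'I_N} := [set k | if k is inl _ then true else
  false]%SET.
have := indep J (fun k => if k is inl i then X i @^-1` A i else setT).
have -> : \bigcap_(k in [set k | k \in J])
    (if k is inl i then X i @^-1` A i else setT) =
    \bigcap_(i in [set: 'I_N]) (X i @^-1` A i).
  apply/seteqP; split => w H.
    by move=> i _; apply: (H (inl i)); rewrite /= inE.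
  by case => [i|?] //= _; exact: H.
move=> ->; last first.
  by case => [i _|k]; [exists (A i); rewrite ?setTI|rewrite inE].
rewrite big_sumType /= [X in (_ * X)%E]big1 ?mule1; last first.
  by move=> k; rewrite inE.
by apply: eq_big => [i|i _]; [rewrite inE|exact: law].
Qed.

Lemma iid_data_coins_law (A : 'I_N -> set R) b : (forall i, measurable (A i)) ->
  P ((\bigcap_(i in [set: 'I_N]) (X i @^-1` A i)) `&`
     coins_at L c @^-1` [set b]) =
  (P (\bigcap_(i in [set: 'I_N]) (X i @^-1` A i)) *
   (coins_weight (eps / L%:R) b)%:E)%E.
Proof.
move=> mA; rewrite iid_data_law//; case: exp => law claw indep.
pose E (k : 'I_N + 'I_L * 'I_N) := match k with
  | inl i => X i @^-1` A i | inr (t, i) => c t i @^-1` [set b t i] end.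
have -> : (\bigcap_(i in [set: 'I_N]) (X i @^-1` A i)) `&`
    coins_at L c @^-1` [set b] =
    \bigcap_(k in [set k | k \in [set: 'I_N + 'I_L * 'I_N]%SET]) E k.
  rewrite coins_at_preimage; apply/seteqP; split => w.
    by move=> [H1 H2] [i|[t i]] _; [exact: H1|exact: (H2 (t, i))].
  move=> H; split; first by move=> i _; apply: (H (inl i)); rewrite /= inE.
  by move=> [t i] _; apply: (H (inr (t, i))); rewrite /= inE.
rewrite indep; last first.
  case => [i _|[t i] _]; first by exists (A i); rewrite ?setTI.
  by exists [set b t i] => //; rewrite setTI.
rewrite big_sumType /=; congr (_ * _)%E.
  by apply: eq_big => [i|i _]; [rewrite inE|exact: law].
rewrite /coins_weight /round_weight pair_bigA /= -prodEFin.
apply: eq_big => [k|[t i] _ /=]; first by rewrite inE.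
by rewrite (coin_lawE _ (claw t i)).
Qed.

Variables (K : finType) (S : K -> set R).
Hypothesis mS : forall k, measurable (S k).

Definition code (y : R) : {ffun K -> bool} := [ffun k => y \in S k].

Definition decode (u : {ffun K -> bool}) : R := xget 0 [set y | code y = u].

Lemma codeK y k : (decode (code y) \in S k) = (y \in S k).
Proof.
have : code (decode (code y)) = code y.
  by apply: (@xgetPex _ 0 [set z | code z = code y]); exists y.
by move/ffunP => /(_ k); rewrite !ffunE.
Qed.

Lemma measurable_code u : measurable (code @^-1` [set u]).
Proof.
have -> : code @^-1` [set u] =
    \bigcap_(k in [set: K]) (if u k then S k else ~` S k).
  apply/seteqP; split => y /=.
    by move=> <- k _; rewrite ffunE; case: (asboolP (S k y)); rewrite ?inE => H;
      [rewrite mem_set|rewrite memNset].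
  move=> H; apply/ffunP => k; rewrite ffunE; move: (H k I).
  by case: (u k) => ?; [rewrite mem_set|rewrite memNset].
apply: fin_bigcap_measurable; first exact: finite_finset.
by move=> k _; case: (u k) => //; exact: measurableC.
Qed.

Definition codes_at (w : Omega) : {ffun 'I_N -> {ffun K -> bool}} :=
  [ffun i => code (X i w)].

Lemma codes_at_preimage u : codes_at @^-1` [set u] =
  \bigcap_(i in [set: 'I_N]) (X i @^-1` (code @^-1` [set u i])).
Proof.
apply/seteqP; split => w /=.
  by move=> <- i _ /=; rewrite !ffunE.
by move=> H; apply/ffunP => i; rewrite ffunE; exact: H.
Qed.

Lemma measurable_codes_at u : measurable (codes_at @^-1` [set u]).
Proof.
rewrite codes_at_preimage; apply: fin_bigcap_measurable;
  first exact: finite_finset.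
by move=> k _; apply: measurable_funPTI; exact: measurable_code.
Qed.

(** Averaging over the coins with the data held fixed. The quantities f and g
    depend on the data only through their code, so the expectations are finite
    sums over pairs of a code and an array of coins, and these two are
    independent. *)
Lemma iid_condition (f : ('I_N -> R) -> coin_array L N -> R)
    (g : ('I_N -> R) -> R) :
  (forall x x', (forall i k, (x i \in S k) = (x' i \in S k)) ->
     f x =1 f x' /\ g x = g x') ->
  (forall x b, 0 <= f x b) ->
  (forall x, \sum_b coins_weight (eps / L%:R) b * f x b <= g x) ->
  ('E_P[fun w => f (X^~ w) (coins_at L c w)] <= 'E_P[fun w => g (X^~ w)])%E.
Proof.
move=> fg_code f0 fg.
have codeE w : f (X^~ w) =1 f (fun i => decode (codes_at w i)) /\
    g (X^~ w) = g (fun i => decode (codes_at w i)).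
  by apply: fg_code => i k; rewrite ffunE codeK.
have -> : (fun w => f (X^~ w) (coins_at L c w)) =
    (fun p : {ffun 'I_N -> {ffun K -> bool}} * coin_array L N =>
       f (fun i => decode (p.1 i)) p.2) \o
    (fun w => (codes_at w, coins_at L c w)).
  by apply/funext => w /=; rewrite (codeE w).1.
have -> : (fun w => g (X^~ w)) =
    (fun u : {ffun 'I_N -> {ffun K -> bool}} => g (fun i => decode (u i))) \o
      codes_at.
  by apply/funext => w /=; rewrite (codeE w).2.
have pairE u b : (fun w => (codes_at w, coins_at L c w)) @^-1` [set (u, b)] =
    (codes_at @^-1` [set u]) `&` (coins_at L c @^-1` [set b]).
  by apply/seteqP; split => w /= [-> ->].
rewrite finite_expectation; last 2 first.
- move=> [u b]; rewrite pairE; apply: measurableI;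
  first exact: measurable_codes_at.
  exact: measurable_coins_at.
- by move=> y; exact: f0.
rewrite finite_expectation; last 2 first.
- exact: measurable_codes_at.
- move=> u; apply: le_trans (fg _); apply: sumr_ge0 => b _.
  by rewrite mulr_ge0// coins_weight_ge0.
rewrite [leLHS](_ : _ = \sum_(u : {ffun 'I_N -> {ffun K -> bool}}) \sum_b
    (f (fun i => decode (u i)) b)%:E *
    P ((codes_at @^-1` [set u]) `&` (coins_at L c @^-1` [set b])))%E;
      last first.
  by rewrite pair_bigA; apply: eq_bigr => -[u b] _; rewrite pairE.
apply: lee_sum => u _.
under eq_bigr => b _.
  rewrite codes_at_preimage iid_data_coins_law; last first.
    by move=> i; exact: measurable_code.
  rewrite -codes_at_preimage muleCA.
  over.
rewrite -ge0_sume_distrr; last first.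
  by move=> b _; rewrite -EFinM lee_fin mulr_ge0// coins_weight_ge0.
rewrite muleC; apply: lee_wpmul2r => //.
under eq_bigr do rewrite -EFinM mulrC.
by rewrite sumEFin lee_fin.
Qed.

End IidLaw.

(** * Consequences of fatness and of the data settings *)

Section DataFunction.
Context {R : realType}.
Variable F : R -> R.
Hypothesis dF : data_function F.

Lemma data_function_eq0 tau : -1 <= tau -> tau < xmin F -> tau <= 1 -> F tau =
  0.
Proof.
move=> t1 tm t2; apply/eqP; rewrite eq_le; apply/andP; split; last first.
  by have /andP[] : 0 <= F tau <= 1 by apply: dF.1; rewrite t1 t2.
rewrite leNgt; apply/negP => F0.
have : xmin F <= tau.
  apply: ge_inf; last by split => //; rewrite t1 t2.
  by exists (-1) => y [/andP[]].
by rewrite leNgt tm.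
Qed.

(** If F vanishes on [-1, 1], then xmin is the infimum 0 of the empty set. *)
Lemma xmin_ge : -1 <= xmin F.
Proof.
rewrite /xmin; set A := [set x | _].
have [->|] := eqVneq A set0; first by rewrite inf0; lra.
by move=> /set0P A0; apply: lb_le_inf => // y [/andP[]].
Qed.

Lemma fat_quantile alpha C xbar delta g : fat_with alpha C xbar F ->
  0 < delta -> xmin F + delta < xbar -> g <= C * delta `^ alpha ->
  g <= F (xmin F + delta).
Proof.
move=> [C0 _ _ fat] d0 dx /le_trans; apply.
have := fat (xmin F + delta); rewrite addrAC subrr add0r; apply.
by rewrite dx ltrDl d0.
Qed.

Lemma sum_lt_natr_ge n (y : R) : y <= n%:R -> y <= \sum_(0 <= k < n) (k%:R <
  y)%R%:R.
Proof.
elim: n => [|n IH] yn; first by rewrite big_nil.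
have [ny|yn'] := ltP n%:R y.
  rewrite (@eq_big_nat _ _ _ _ _ _ (fun=> 1)); last first.
    move=> k /andP[_ kn]; rewrite (le_lt_trans _ ny)// ler_nat -ltnS//.
  by rewrite sumr_const_nat subn0.
rewrite big_nat_recr//=; apply: (le_trans (IH yn')).
by rewrite lerDl.
Qed.

(** The order statistic of rank k (from 0) lies below a as soon as
    k / (N - 1) < F(a), by monotonicity of F, and at least (N - 1) F(a) of the
    ranks 0, ..., N - 1 satisfy this. *)
Lemma fixed_data_count N (x : 'I_N -> R) a : (2 <= N)%N -> fixed_data F x ->
  -1 <= a <= 1 -> (N.-1)%:R * F a <= \sum_i (x i <= a)%R%:R.
Proof.
move=> N2 [x11 Fx x0] a11; set s := sort <=%O (codom x).
have sz : size s = N by rewrite size_sort size_codom card_ord.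
have -> : \sum_i (x i <= a)%R%:R = \sum_(y <- s) (y <= a)%R%:R :> R.
  by rewrite (perm_big _ (permEl (perm_sort _ _))) /= big_image.
have N1 : 0 < (N.-1)%:R :> R by rewrite ltr0n -ltnS prednK// ltnW.
rewrite (big_nth 0) sz.
apply: (@le_trans _ _ (\sum_(0 <= k < N) (k%:R < (N.-1)%:R * F a)%R%:R)).
  apply: sum_lt_natr_ge; apply: (@le_trans _ _ (N.-1)%:R).
    by rewrite ler_piMr//; have /andP[] := dF.1 _ a11.
  by rewrite ler_nat leq_pred.
rewrite !big_nat; apply: ler_sum => k /andP[_ kN].
rewrite ler_nat; case: (ltrP k%:R) => // kF.
rewrite lt0b; apply: contraT; rewrite -ltNge => ax.
have sk11 : -1 <= nth 0 s k <= 1.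
  have : nth 0 s k \in codom x by rewrite -(mem_sort <=%O) mem_nth// sz.
  by move=> /codomP[i ->].
have : F a <= F (nth 0 s k).
  by apply: dF.2; [case/andP: a11|exact: ltW|case/andP: sk11].
rewrite -/(order_stat x k) Fx// ler_pdivlMr// mulrC.
by rewrite leNgt kF.
Qed.

Lemma fixed_data_ge_xmin N (x : 'I_N -> R) i : fixed_data F x -> xmin F <= x i.
Proof.
move=> [x11 Fx <-]; rewrite /order_stat; set s := sort <=%O (codom x).
have sz : size s = N by rewrite size_sort size_codom card_ord.
have : x i \in s by rewrite mem_sort codom_f.
move=> /(nthP 0)[k ks <-].
apply: (sorted_leq_nth le_trans lexx 0 (sort_le_sorted (codom x))) => //.
by rewrite inE; apply: leq_ltn_trans ks.
Qed.

(** The half-line is a countable union of half-lines that end strictly below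
    xmin. Each is null: F vanishes at its endpoint or, as F describes mu on
    [-1, 1] only, it misses the support [-1, 1] of mu. *)
Lemma mu_below_xmin (mu : probability R R) : cdf_on F mu -> xmin F <= 1 ->
  mu `]-oo, xmin F[%classic = 0%E.
Proof.
move=> [mu1 cdf] m1; apply: measure_negligible; first exact: measurable_itv.
have null q : q < xmin F -> mu.-negligible `]-oo, q]%classic.
  move=> qm; apply/negligibleP; first exact: measurable_itv.
  have q1 : q <= 1 by rewrite ltW// (lt_le_trans qm).
  have [q0|q0] := lerP (-1) q.
    by apply: etrans (cdf q _) _; rewrite ?q0// data_function_eq0.
  apply/eqP; rewrite -measure_le0.
  apply: (@le_trans _ _ (mu (~` `[-1, 1]%classic))).
    apply: le_measure; rewrite ?inE; [exact: measurable_itv|..].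
      by apply: measurableC; exact: measurable_itv.
    move=> y /=; rewrite !in_itv /= => yq /andP[y1 _].
    by have := le_lt_trans (le_trans y1 yq) q0; rewrite ltxx.
  by rewrite probability_setC ?mu1 ?subee//; exact: measurable_itv.
apply: (negligibleS (A :=
    (\bigcup_n `]-oo, xmin F - n.+1%:R^-1]%classic))).
  move=> y /=; rewrite in_itv /= => ym.
  have d0 : 0 < xmin F - y by rewrite subr_gt0.
  have [n _ nd] := near_infty_natSinv_lt (PosNum d0).
  by exists n => //=; rewrite in_itv /=; have := ltW (nd n (leqnn n));
    rewrite /= lerBrDr -lerBrDl.
by apply: negligible_bigcup => n; apply: null; rewrite ltrBlDr ltrDl invr_gt0.
Qed.

End DataFunction.

(** * Error bounds for a fixed number of users *)

Section Bounds.
Context {R : realType}.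

(** The two assumptions on x are what fixed data satisfy always, and i.i.d. data
    with high probability. *)
Lemma good_data_error (N L : nat) (eps h m a : R) (x : 'I_N -> R) :
  (0 < N)%N -> (0 < L)%N -> 0 < eps -> 0 < h -> -1 <= m <= 1 -> m <= a ->
  let gamma := threshold eps h L N in
  (forall i, m <= x i) -> 2 * gamma * N%:R <= \sum_i (x i <= a)%R%:R ->
  \sum_(b : coin_array L N)
     coins_weight (eps / L%:R) b * `|m - xtilde L eps gamma x (coins_of b)|
  <= (a - m) + 2 ^- L + 2 * expR (- h).
Proof.
move=> N0 L0 eps0 h0 m11 ma /= mx cnt; apply: finite_error => // tau.
apply: le_trans (wrong_turn_weight tau N0 _ (sqrtr_ge0 _) ma mx cnt) _.
  by rewrite divr_gt0// ltr0n.
by rewrite ler_expR lerN2 threshold_noise.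
Qed.

(** Since e^(eps/L) - 1 >= eps/L, and e^(eps/L) <= e^epsmax. *)
Lemma threshold_le (epsmax eps h : R) (L N : nat) :
  (0 < L)%N -> (0 < N)%N -> 0 < eps <= epsmax -> 0 < h ->
  threshold eps h L N <=
  Num.sqrt (4 * expR epsmax * (1 + expR epsmax)) * Num.sqrt (rate eps h L N).
Proof.
move=> L0 N0 /andP[eps0 epsm] h0.
have L0' : 1 <= L%:R :> R by rewrite ler1n.
have N0' : 0 < N%:R :> R by rewrite ltr0n.
have E0 : 0 < expR epsmax by exact: expR_gt0.
rewrite -sqrtrM; last by rewrite !mulr_ge0//; lra.
rewrite ler_wsqrtr//; set e := expR (eps / L%:R).
have epsL : 0 < eps / L%:R by rewrite divr_gt0//; lra.
have e1 : eps / L%:R <= e - 1 by have := expR_ge1Dx (eps / L%:R); rewrite /e;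
  lra.
have eE : e <= expR epsmax.
  rewrite ler_expR (le_trans _ epsm)// ler_pdivrMr; last lra.
  by rewrite ler_peMr// ltW.
have -> : rate eps h L N = ((eps / L%:R) ^+ 2)^-1 * (h / N%:R).
  by rewrite /rate; field; rewrite !gt_eqF//; lra.
have -> : 4 * e * (1 + e) * h / ((e - 1) ^+ 2 * N%:R) =
    4 * e * (1 + e) * (((e - 1) ^+ 2)^-1 * (h / N%:R)).
  by field; rewrite gt_eqF//=; lra.
have hN : 0 <= h / N%:R by rewrite divr_ge0// ltW.
have e0 : 0 < e by exact: expR_gt0.
apply: ler_pM.
- by rewrite !mulr_ge0//; lra.
- by rewrite mulr_ge0// invr_ge0 sqr_ge0.
- by rewrite ler_pM//; lra.
rewrite ler_wpM2r// lef_pV2 ?posrE ?exprn_gt0//; last lra.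
by apply: lerXn2r => //; rewrite nnegrE; lra.
Qed.

Lemma fixed_error (N L : nat) (eps h m a : R) (x : 'I_N -> R)
    (d : measure_display) (Omega : measurableType d) (P : probability Omega R)
    (c : nat -> 'I_N -> {RV P >-> bool}) :
  (0 < N)%N -> (0 < L)%N -> 0 < eps -> 0 < h -> -1 <= m <= 1 -> m <= a ->
  let gamma := threshold eps h L N in
  (forall i, m <= x i) -> 2 * gamma * N%:R <= \sum_i (x i <= a)%R%:R ->
  fresh_coins L eps c ->
  (Err L eps gamma m (fun i => cst (x i)) c
   <= ((a - m) + 2 ^- L + 2 * expR (- h))%:E)%E.
Proof.
move=> N0 L0 eps0 h0 m11 ma gamma mx cnt fc; rewrite /Err.
have -> : (fun w => `|m - xtilde L eps gamma ((fun i => cst (x i))^~ w)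
      (fun t i => c t i w)|) =
    (fun b => `|m - xtilde L eps gamma x (coins_of b)|) \o coins_at L c.
  by apply/funext => w; rewrite /xtilde (search_coins_at (L := L)).
rewrite finite_expectation//; last exact: measurable_coins_at.
under eq_bigr do rewrite (coins_at_law _ fc) -EFinM mulrC.
by rewrite sumEFin lee_fin good_data_error.
Qed.

End Bounds.

Section Iid.
Context {R : realType} {d : measure_display} {Omega : measurableType d}.
Context (P : probability Omega R) (N L : nat) (eps : R) (mu : probability R R).
Context (X : 'I_N -> {RV P >-> R}) (c : nat -> 'I_N -> {RV P >-> bool}).
Hypothesis exp : iid_experiment L eps mu X c.

Lemma few_data_event (a n : R) :
  [set w | \sum_i (X i w <= a)%R%:R < n] =
  (fun w => [ffun i => X i w <= a] : {ffun 'I_N -> bool}) @^-1`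
    [set v : {ffun 'I_N -> bool} | \sum_i (v i)%:R < n].
Proof.
apply/funext => w; rewrite /preimage /=; congr (is_true (_ < n)).
by apply: eq_bigr => i _; rewrite ffunE.
Qed.

Lemma below_pattern_event (a : R) v :
  (fun w => [ffun i => X i w <= a] : {ffun 'I_N -> bool}) @^-1` [set v] =
  \bigcap_(i in [set: 'I_N]) (X i @^-1` (if v i then `]-oo, a] else `]a,
    +oo[)%classic).
Proof.
apply/seteqP; split => w /=.
  by move=> <- i _ /=; rewrite ffunE; case: ifPn => Xa;
    rewrite /= in_itv //= ?andbT ltNge.
move=> H; apply/ffunP => i; rewrite ffunE; have := H i I.
by case: (v i); rewrite /= in_itv /= ?andbT// ltNge => /negPf.
Qed.

Lemma measurable_below_pattern (a : R) v : measurable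
  ((fun w => [ffun i => X i w <= a] : {ffun 'I_N -> bool}) @^-1` [set v]).
Proof.
rewrite below_pattern_event; apply: fin_bigcap_measurable;
  first exact: finite_finset.
by move=> k _; apply: measurable_funPTI; case: (v k); exact: measurable_itv.
Qed.

Lemma measurable_few_data (a n : R) :
  measurable [set w | \sum_i (X i w <= a)%R%:R < n].
Proof.
rewrite few_data_event; apply: measurable_finite_preimage.
exact: measurable_below_pattern.
Qed.

(** Hoeffding's inequality for the number of data at most a, which is a sum of
    N independent indicators of mean p. *)
Lemma few_data_probability (a p s : R) : (0 < N)%N -> 0 <= s ->
  mu `]-oo, a]%classic = p%:E ->
  (P [set w | (\sum_i (X i w <= a)%R%:R < p * N%:R - s)%R]
   <= (expR (- (s ^+ 2 / N%:R)))%:E)%E.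
Proof.
move=> N0 s0 mup.
have p0 : 0 <= p by rewrite -lee_fin -mup.
have p1 : p <= 1 by rewrite -lee_fin -mup probability_le1//;
  exact: measurable_itv.
have muq : mu `]a, +oo[%classic = (1 - p)%:E.
  by rewrite -setCitvl probability_setC ?mup//; exact: measurable_itv.
rewrite few_data_event finite_probability; last exact: measurable_below_pattern.
pose w (b : bool) : R := if b then p else 1 - p.
have := @hoeffding R 'I_N (fun=> w) (fun _ b => p - b%:R) s.
rewrite card_ord => /(_ N0 s0) H.
apply: (@le_trans _ _ (\sum_(v : {ffun 'I_N -> bool}) (\prod_i w (v i)) *
    (s <= \sum_i (p - (v i)%:R))%R%:R)%:E); last first.
  rewrite lee_fin; apply: H => [_ []|_|_|_]; rewrite /w /=; lra.
rewrite -sumEFin; apply: lee_sum => v _.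
rewrite below_pattern_event (iid_data_law exp); last first.
  by move=> i; case: (v i); exact: measurable_itv.
rewrite (eq_bigr (fun i => (w (v i))%:E)); last first.
  by move=> i _; rewrite /w; case: (v i).
rewrite prodEFin -EFinM lee_fin mulrC; apply: ler_wpM2l.
  by apply: prodr_ge0 => i _; rewrite /w; case: ifP; rewrite ?subr_ge0.
rewrite ler_nat; case: (boolP (v \in _)) => //; rewrite inE /= => vlt.
rewrite sumrB sumr_const card_ord -mulr_natr.
by rewrite lt0b lerBrDl -lerBrDr ltW.
Qed.

(** Conditioning on the data gives the bound of [good_data_error] on good data.
    Bad data have probability at most e^(-h), and both m and the output lie in
    [-1, 1], so bad data add at most 2 e^(-h). *)
Lemma iid_error (h m a : R) : (0 < N)%N -> (0 < L)%N -> 0 < eps -> 0 < h ->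
  -1 <= m <= 1 -> m <= a ->
  let gamma := threshold eps h L N in
  mu `]-oo, m[%classic = 0%E ->
  (exists2 p, 4 * gamma <= p & mu `]-oo, a]%classic = p%:E) ->
  (Err L eps gamma m X c <= ((a - m) + 2 ^- L + 4 * expR (- h))%:E)%E.
Proof.
move=> N0 L0 eps0 h0 m11 ma gamma mum [p gp mup].
have N0' : 0 < N%:R :> R by rewrite ltr0n.
have gamma0 : 0 <= gamma := sqrtr_ge0 _.
pose few (x : 'I_N -> R) := \sum_i (x i <= a)%R%:R < 2 * gamma * N%:R.
pose bad (x : 'I_N -> R) := [exists i, x i < m] || few x.
set B := (a - m) + 2 ^- L + 2 * expR (- h).
have B0 : 0 <= B.
  by rewrite /B addr_ge0 ?mulr_ge0 ?expR_ge0// addr_ge0 ?subr_ge0.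
pose Bad := [set w | bad (X^~ w)].
pose High := \bigcap_(i in [set: 'I_N]) (X i @^-1` (~` `]-oo, m[%classic)).
have BadE : Bad = ~` High `|` [set w | few (X^~ w)].
  apply/seteqP; split => w /=.
    move=> /orP[/existsP[i im]|]; last by right.
    by left => /(_ i I) /=; apply; rewrite in_itv.
  move=> [nH|fw]; rewrite /Bad /bad /=; last by rewrite fw orbT.
  apply: contrapT => /negP; rewrite negb_or => /andP[/existsPn H _].
  by apply: nH => i _ /=; rewrite in_itv /=; exact/negP.
have mlow : measurable (`]-oo, m[%classic : set R) by exact: measurable_itv.
have mfew : measurable [set w | few (X^~ w)] := measurable_few_data _ _.
have mHigh : measurable High.
  apply: fin_bigcap_measurable; first exact: finite_finset.
  by move=> i _; apply: measurable_funPTI; exact: measurableC.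
have mBad : measurable Bad.
  by rewrite BadE; apply: measurableU => //; exact: measurableC.
have PBad : (P Bad <= (expR (- h))%:E)%E.
  rewrite BadE.
  apply: (@le_trans _ _ (P (~` High) + P [set w | few (X^~ w)])%E).
    by apply: measureU2 => //; exact: measurableC.
  rewrite probability_setC// (iid_data_law exp (A := fun=> ~` `]-oo,
    m[%classic)); last first.
    by move=> _; exact: measurableC.
  rewrite big1 ?subee// ?add0e; last first.
    by move=> i _; rewrite probability_setC// mum sube0.
  (* As p >= 4 gamma, having fewer than 2 gamma N data below a is a deviation
     of at least 2 gamma N from the mean p N. *)
  have gN0 : 0 <= 2 * gamma * N%:R by rewrite !mulr_ge0// ltW.
  apply: le_trans (le_trans _ (few_data_probability N0 gN0 mup)) _.
    apply: le_measure; rewrite ?inE//; first exact: measurable_few_data.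
    move=> w /= /lt_le_trans; apply.
    by rewrite lerBrDl -!mulrDl ler_pM2r//; lra.
  rewrite lee_fin ler_expR lerN2.
  apply: le_trans (threshold_noise L0 N0 eps0 h0) _.
  rewrite -/gamma ler_pM2r ?invr_gt0//; set e := expR _.
  have e1 : 1 < e by rewrite expR_gt1 divr_gt0// ltr0n.
  have e2 : 0 <= (e - 1) / (e + 1) by rewrite divr_ge0//; lra.
  have e3 : (e - 1) / (e + 1) <= 2 by rewrite ler_pdivrMr//; lra.
  have gN0' : 0 <= gamma * N%:R by rewrite mulr_ge0// ltW.
  apply: lerXn2r; rewrite ?nnegrE//; first by rewrite mulr_ge0.
  by rewrite -[leRHS]mulrA [leRHS]mulrC ler_wpM2l.
pose probe (k : option (option 'I_(2 ^ L))) : set R :=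
  match k with
  | None => `]-oo, m[%classic | Some None => `]-oo, a]%classic
  | Some (Some j) => `]-oo, node L j]%classic
  end.
rewrite /Err.
have -> : (fun w => `|m - xtilde L eps gamma (X^~ w) (fun t i => c t i w)|) =
    (fun w => `|m - xtilde L eps gamma (X^~ w) (coins_of (coins_at L c w))|).
  by apply/funext => w; rewrite /xtilde (search_coins_at (L := L)).
have mS k : measurable (probe k).
  by case: k => [[j|]|]; exact: measurable_itv.
have codeP x x' : (forall (i : 'I_N) k, (x i \in probe k) = (x' i \in probe
  k)) ->
    (forall b : coin_array L N,
       xtilde L eps gamma x (coins_of b) = xtilde L eps gamma x' (coins_of b))
    /\ bad x = bad x'.
  move=> xx'; split.
    move=> b; rewrite /xtilde (@eq_search_data _ _ _ _ L x x')// => i j jL.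
    have := xx' i (Some (Some (Ordinal jL))).
    by rewrite /= !mem_setE !in_itv /=.
  have xa i : (x i <= a) = (x' i <= a).
    by have := xx' i (Some None); rewrite /= !mem_setE !in_itv /=.
  have xm i : (x i < m) = (x' i < m).
    by have := xx' i None; rewrite /= !mem_setE !in_itv /=.
  by rewrite /bad /few (eq_existsb xm); under eq_bigr do rewrite xa.
apply: (@le_trans _ _ ('E_P[fun w => (B + 2 * (bad (X^~ w))%:R)%R])%E).
  pose f (x : 'I_N -> R) (b : coin_array L N) : R :=
    `|m - xtilde L eps gamma x (coins_of b)|.
  pose g (x : 'I_N -> R) : R := B + 2 * (bad x)%:R.
  apply: (@iid_condition _ _ _ _ _ _ _ _ _ _ exp _ _ mS f g)
    => [x x' /codeP[E1 E2]|x b|x]; rewrite /f /g.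
  - by split; [move=> b; rewrite E1|rewrite E2].
  - exact: normr_ge0.
  - case: (boolP (bad x)) => bx.
      apply: (@le_trans _ _ (\sum_(b : coin_array L N)
          coins_weight (eps / L%:R) b * 2)).
        apply: ler_sum => b _; apply: ler_wpM2l; first exact: coins_weight_ge0.
        have := mid_search_bounds (eps / L%:R) gamma x (coins_of b) L.
        rewrite -/(xtilde L eps gamma x (coins_of b)) => /andP[t1 t2].
        by move/andP: m11 => [m1 m2]; rewrite ler_norml; apply/andP; split; lra.
      by rewrite -mulr_suml coins_weight_sum mul1r mulr1 lerDr.
    rewrite mulr0 addr0; move: bx; rewrite negb_or => /andP[/existsPn xm fx].
    by apply: good_data_error => // [i|]; rewrite leNgt// xm.
rewrite [leLHS](_ : _ = \int[P]_w (B%:E + 2%:E * (\1_Bad w)%:E))%E; last first.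
  by rewrite unlock; apply: eq_integral => w _; rewrite indicE mem_setE.
rewrite ge0_integralD//; last first.
  by apply: measurable_funeM; apply/measurable_EFinP; exact: measurable_indic.
rewrite ge0_integralZl_EFin//; last first.
  by apply/measurable_EFinP; exact: measurable_indic.
rewrite integral_indic// setIT integral_cst//.
rewrite [X in (_ * X + _)%E](_ : _ = 1%E) ?mule1; last exact: probability_setT.
apply: (@le_trans _ _ (B%:E + 2%:E * (expR (- h))%:E)%E).
  by rewrite leeD2l// lee_wpmul2l.
by rewrite -EFinM -EFinD lee_fin /B; lra.
Qed.

End Iid.

(** * Choice of the margin and conclusion *)

Section Rate.
Context {R : realType}.

(** The margin delta for which C delta^alpha is a prescribed multiple of the
    square root of the rate. *)
Lemma margin_powR (alpha C A r : R) : 0 < alpha -> 0 < C -> 0 <= A -> 0 <= r ->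
  C * ((A / C) `^ (1 / alpha) * r `^ (1 / (2 * alpha))) `^ alpha = A *
    Num.sqrt r.
Proof.
move=> al0 C0 A0 r0; rewrite powRM ?powR_ge0// -!powRrM.
have -> : 1 / alpha * alpha = 1 by field; rewrite gt_eqF.
have -> : 1 / (2 * alpha) * alpha = 2^-1 by field; rewrite gt_eqF.
rewrite (powRr1 (divr_ge0 A0 (ltW C0))) powR12_sqrt//.
by field; rewrite gt_eqF.
Qed.

Lemma near_small_margin (r : nat -> R) (k b gap : R) : 0 < k -> 0 < b ->
  0 < gap -> (forall N, (2 <= N)%N -> 0 < r N) -> r N @[N --> \oo] --> 0 ->
  \forall N \near \oo, k * r N `^ b < gap.
Proof.
move=> k0 b0 gap0 r0 rcv.
have gk0 : 0 < gap / k by rewrite divr_gt0.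
have rho0 : 0 < (gap / k) `^ b^-1 by exact: powR_gt0.
near=> N.
have N2 : (2 <= N)%N by near: N; exact: nbhs_infty_ge.
have rN : r N < (gap / k) `^ b^-1 by near: N; exact: cvgr_lt rho0.
rewrite -ltr_pdivlMl// mulrC.
have -> : gap / k = ((gap / k) `^ b^-1) `^ b.
  by rewrite -powRrM mulVf ?gt_eqF// powRr1// ltW.
by apply: gt0_ltr_powR => //; rewrite nnegrE ltW// r0.
Unshelve. all: by end_near. Qed.

End Rate.

Theorem theorem2 (R : realType) :
  (forall (N L : nat) (eps gamma : R) (d : measure_display)
      (Omega : measurableType d) (P : probability Omega R)
      (c : nat -> 'I_N -> {RV P >-> bool}),
    (2 <= N)%N -> (0 < L)%N -> 0 < eps -> fresh_coins L eps c ->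
    locally_private P eps
      (fun x w => transcript L eps gamma x (fun t i => c t i w)))
  /\
  (forall alpha C xbar epsmax : R, 0 < alpha ->
    exists2 K : R, 0 < K &
    forall (F : R -> R) (L : nat -> nat) (eps h : nat -> R),
      data_function F -> fat_with alpha C xbar F ->
      (forall N, (2 <= N)%N ->
        [/\ (0 < L N)%N, 0 < eps N <= epsmax & 0 < h N]) ->
      rate (eps N) (h N) (L N) N @[N --> \oo] --> 0 ->
      (* fixed data *)
      (forall x : forall N : nat, 'I_N -> R,
        (forall N, (2 <= N)%N -> fixed_data F (x N)) ->
        \forall N \near \oo,
          forall (d : measure_display) (Omega : measurableType d)
            (P : probability Omega R) (c : nat -> 'I_N -> {RV P >-> bool}),
          fresh_coins (L N) (eps N) c ->
          (Err (L N) (eps N) (threshold (eps N) (h N) (L N) N) (xmin F)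
             (fun i => cst (x N i)) c
           <= (K * error_bound alpha (eps N) (h N) (L N) N)%:E)%E)
      /\
      (* i.i.d. data *)
      (forall mu : probability R R,
        cdf_on F mu ->
        \forall N \near \oo,
          forall (d : measure_display) (Omega : measurableType d)
            (P : probability Omega R) (X : 'I_N -> {RV P >-> R})
            (c : nat -> 'I_N -> {RV P >-> bool}),
          iid_experiment (L N) (eps N) mu X c ->
          (Err (L N) (eps N) (threshold (eps N) (h N) (L N) N) (xmin F) X c
           <= (K * error_bound alpha (eps N) (h N) (L N) N)%:E)%E)).
Proof.
split=> [N L eps gamma d Omega P c _|alpha C xbar epsmax al0].
  exact: fresh_coins_private.
pose A : R := Num.sqrt (4 * expR epsmax * (1 + expR epsmax)).
have A0 : 0 < A.
  by have := expR_gt0 epsmax; rewrite /A sqrtr_gt0 => e0; rewrite !mulr_gt0//;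
    lra.
pose K0 := (4 * A / C) `^ (1 / alpha).
have K00 : 0 <= K0 by exact: powR_ge0.
exists (K0 + 4); first lra.
move=> F L eps h dF fat params rate_cv.
have [C0 xbar11 mxbar _] := fat.
have m11 : -1 <= xmin F <= 1.
  by rewrite (xmin_ge F) ltW// (lt_le_trans mxbar)//; case/andP: xbar11.
have r0 N : (2 <= N)%N -> 0 < rate (eps N) (h N) (L N) N.
  move=> N2; have [L0 /andP[eps0 _] h0] := params N N2.
  by rewrite /rate divr_gt0// mulr_gt0// ?exprn_gt0// ltr0n// ltnW.
pose b := 1 / (2 * alpha).
pose margin N := K0 * rate (eps N) (h N) (L N) N `^ b.
have near_margin : \forall N \near \oo,
    (2 <= N)%N /\ xmin F + margin N < xbar.
  near=> N; split; first by near: N; exact: nbhs_infty_ge.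
  rewrite -ltrBrDl; near: N; apply: near_small_margin => //.
  - by apply: powR_gt0; rewrite !mulr_gt0// invr_gt0.
  - by rewrite divr_gt0// mulr_gt0.
  - by rewrite subr_gt0.
have margin_gt0 N : (2 <= N)%N -> 0 < margin N.
  move=> N2; apply: mulr_gt0; last by apply: powR_gt0; exact: r0.
  by apply: powR_gt0; rewrite !mulr_gt0// invr_gt0.
have quantile N : (2 <= N)%N -> xmin F + margin N < xbar ->
    4 * threshold (eps N) (h N) (L N) N <= F (xmin F + margin N).
  move=> N2 mN; have [L0 epsN h0] := params N N2.
  apply: (fat_quantile fat _ mN); first exact: margin_gt0.
  have A4 : 0 <= 4 * A by rewrite mulr_ge0// ltW.
  rewrite (margin_powR al0 C0 A4 (ltW (r0 N N2))) -mulrA ler_pM2l//.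
  by apply: threshold_le => //; exact: ltnW.
have a11 N : (2 <= N)%N -> xmin F + margin N < xbar ->
    -1 <= xmin F + margin N <= 1.
  move=> N2 mN; have := margin_gt0 N N2; case/andP: m11; case/andP: xbar11 => *.
  by apply/andP; split; lra.
have total N (k : R) : (2 <= N)%N -> k <= 4 ->
    xmin F + margin N - xmin F + 2 ^- L N + k * expR (- h N) <=
    (K0 + 4) * error_bound alpha (eps N) (h N) (L N) N.
  move=> N2 k4; rewrite /error_bound -/b (addrC (xmin F)) addrK /margin.
  have : 0 < rate (eps N) (h N) (L N) N `^ b by apply: powR_gt0; exact: r0.
  have := expR_gt0 (- h N); have : 0 < 2 ^- L N :> R by rewrite invr_gt0
    exprn_gt0.
  move: (2 ^- L N) (expR _) (rate _ _ _ _ `^ b) => u v r u0 v0 r0'.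
  have := mulr_ge0 K00 (ltW u0); have := mulr_ge0 K00 (ltW v0).
  have := ler_wpM2r (ltW v0) k4; lra.
split=> [x fx|mu cdfmu].
  near=> N; move=> d Omega P c fc.
  have [N2 mN] : (2 <= N)%N /\ xmin F + margin N < xbar by near: N.
  have [L0 /andP[eps0 _] h0] := params N N2.
  have ma : xmin F <= xmin F + margin N by rewrite lerDl ltW// margin_gt0.
  apply: (le_trans (fixed_error (ltnW N2) L0 eps0 h0 m11 ma _ _ fc)).
  - by move=> i; exact: (fixed_data_ge_xmin _ (fx N N2)).
  - apply: le_trans (fixed_data_count dF N2 (fx N N2) (a11 N N2 mN)).
    have q := quantile N N2 mN.
    have g0 : 0 <= threshold (eps N) (h N) (L N) N := sqrtr_ge0 _.
    have N1 : 1 <= (N.-1)%:R :> R by rewrite ler1n -ltnS prednK// ltnW.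
    have -> : N%:R = (N.-1)%:R + 1 :> R by rewrite natr1 prednK// ltnW.
    apply: le_trans (ler_wpM2l (ler0n _ N.-1) q).
    by have := ler_wpM2l g0 N1; lra.
  - by rewrite lee_fin total// ler_nat.
near=> N; move=> d Omega P X c expX.
have [N2 mN] : (2 <= N)%N /\ xmin F + margin N < xbar by near: N.
have [L0 /andP[eps0 _] h0] := params N N2.
have ma : xmin F <= xmin F + margin N by rewrite lerDl ltW// margin_gt0.
apply: (le_trans (iid_error expX (ltnW N2) L0 eps0 h0 m11 ma _ _)).
- by apply: mu_below_xmin => //; case/andP: m11.
- exists (F (xmin F + margin N)); first exact: quantile.
  by apply: cdfmu.2; exact: a11.
- by rewrite lee_fin total.
Unshelve. all: by end_near. Qed.
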